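(* Let $d\geq 1$, $M\in\mathbb{N}$ with $M\geq 2$, and $p\in(M^{-\min\{3,d\}},1]$. Let $F$ be the fractal percolation on $[0,1]^d$ with parameters $M$ and $p$, with construction steps $F_n$ and parts $F_n^j$ as described in the context, let $D=\log(M^dp)/\log M$ and $r=1/M$. Then for each $k\in\{0,\ldots,d\}$ the limit $$\overline{\mathcal V}_k(F):=\lim_{n\to\infty} r^{n(D-k)}\,\mathbb{E} V_k(F_n)$$ exists and equals $$q_{d,k}+\sum_{T\subset\{1,\ldots,M^d\},\,|T|\geq 2}(-1)^{|T|-1}\sum_{n=1}^\infty r^{n(D-k)}\,\mathbb{E} V_k\Big(\bigcap_{j\in T}F_n^j\Big),$$ where $q_{d,k}:=V_k([0,1]^d)$ and all the series over $n$ converge.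
   Context: Fractal percolation: let $J=[0,1]^d$ and $F_0:=J$. Given $F_{n-1}$, a finite union of closed cubes of side length $M^{-(n-1)}$ from the standard $M$-adic grid, each such cube is divided into $M^d$ closed subcubes of side length $M^{-n}$, and each subcube is kept independently (of all other subcubes and of previous steps) with probability $p$; $F_n$ is the union of the kept subcubes. The limit set is $F=\bigcap_n F_n$. Let $J_1,\ldots,J_{M^d}$ be the $M^d$ closed subcubes of side $1/M$ of $J$ (level-1 cubes), and for $j\in\{1,\ldots,M^d\}$, $n\in\mathbb{N}$, let $F_n^j$ be the union of those level-$n$ cubes of $F_n$ that are contained in $J_j$ (empty union $=\emptyset$). $V_0,\ldots,V_d$ denote the intrinsic volumes (Minkowski functionals), additively extended to finite unions of compact convex sets (the convex ring); $V_0$ is the Euler characteristic and $V_k(\emptyset)=0$. *)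

(* Defs.v *)
From HB Require Import structures.
From mathcomp Require Import all_boot all_order all_algebra.
From mathcomp Require Import all_classical all_reals all_analysis.
Set Implicit Arguments. Unset Strict Implicit. Unset Printing Implicit Defensive.
Import Order.TTheory GRing.Theory Num.Theory.
Local Open Scope classical_set_scope.
Local Open Scope ring_scope.

Section Defs.
Variable R : realType.
Variable d : nat.

Definition pt := 'I_d -> R.

Definition boxset (b : pt * pt) : set pt :=
  [set x | forall i, b.1 i <= x i <= b.2 i].

(* k-th intrinsic volume of a nonempty box: elementary symmetric polynomial
   of degree k of its side lengths *)
Definition Vbox_of (k : nat) (b : pt * pt) : R :=
  \sum_(S : {set 'I_d} | #|S| == k) \prod_(i in S) (b.2 i - b.1 i).

(* V_k on (nonempty) boxes; 0 on every set that is not a nonempty box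
   (in particular V_k(emptyset) = 0).  The representation of a nonempty box
   is unique, so the choice below is irrelevant. *)
Definition Vbox (k : nat) (A : set pt) : R :=
  match pselect (exists b : pt * pt, (forall i, b.1 i <= b.2 i) /\ A = boxset b) with
  | left h => Vbox_of k (projT1 (cid h))
  | right _ => 0
  end.

Definition is_box (A : set pt) := exists b : pt * pt, A = boxset b.

Definition incl_excl (k m : nat) (f : 'I_m -> set pt) : R :=
  \sum_(S : {set 'I_m} | (0 < #|S|)%N)
     (-1) ^+ (#|S|.-1) * Vbox k (\bigcap_(i in [set j | j \in S]) f i).

(* Additive extension of V_k to finite unions of boxes (a subclass of the
   convex ring): V_k(A) computed by inclusion-exclusion from any
   representation of A as a finite union of boxes (well defined by the
   additivity of intrinsic volumes); 0 for sets with no such representation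
   (never used in the statement). *)
Definition Vk (k : nat) (A : set pt) : R :=
  match pselect (exists mf : {m : nat & 'I_m -> set pt},
                   (forall i, is_box (projT2 mf i)) /\
                   A = \bigcup_(i in [set: 'I_(projT1 mf)]) projT2 mf i) with
  | left h => incl_excl k (projT2 (projT1 (cid h)))
  | right _ => 0
  end.

Variable M : nat.

Definition cubeset (n : nat) (c : 'I_d -> nat) : set pt :=
  [set x | forall i, (c i)%:R / (M ^ n)%:R <= x i <= (c i).+1%:R / (M ^ n)%:R].

Definition cidx (n : nat) := {ffun 'I_d -> 'I_(M ^ n)}.

(* a configuration of the first n construction steps: for each level
   l+1 (l : 'I_n) and each cube index c, a keep/discard bit.  Only the bits
   (l, c) with all c_i < M^(l+1) are used (they index the level-(l+1) cubes);
   the other bits are independent dummies that do not affect anything. *)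
Definition config (n : nat) := {ffun 'I_n * cidx n -> bool}.

Definition anc (n l : nat) (c : cidx n) : cidx n :=
  [ffun i => Ordinal (leq_ltn_trans (leq_div (c i) (M ^ (n - l))) (ltn_ord (c i)))].

Definition kept (n : nat) (w : config n) (c : cidx n) : bool :=
  [forall l : 'I_n, w (l, anc l.+1 c)].

Definition Fn (n : nat) (w : config n) : set pt :=
  \bigcup_(c in [set c : cidx n | kept w c]) cubeset n (fun i => c i).

Definition Fnj (n : nat) (j : {ffun 'I_d -> 'I_M}) (w : config n) : set pt :=
  \bigcup_(c in [set c : cidx n | kept w c /\
                  cubeset n (fun i => c i) `<=` cubeset 1 (fun i => j i)])
     cubeset n (fun i => c i).

Definition prob (p : R) (n : nat) (w : config n) : R :=
  \prod_(x : 'I_n * cidx n) (if w x then p else 1 - p).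

Definition Exp (p : R) (n : nat) (X : config n -> R) : R :=
  \sum_(w : config n) prob p w * X w.

End Defs.

(* Main.v *)
(* A set which is a finite union of boxes with endpoints in a finite set has
   V_k(A) = sum_h W(h) [y_h in A] for finitely many points y_h and weights W(h)
   depending only on the endpoints; this makes V_k well defined and additive.
   Inclusion-exclusion over the M^d parts F_n^j, each distributed as a copy of
   F_(n-1) scaled by 1/M and kept with probability p, gives for the normalized
   means a_n = r^(n(D-k)) E V_k(F_n) the recursion
     a_n = a_(n-1) + sum_(|T| >= 2) (-1)^(|T|-1) b_T(n).
   If |T| >= 2, the parts F_n^j, j in T, meet inside a common face of two level-1
   cubes, along which there are O(M^(n(d-1))) level-n cubes, each kept with
   probability p^n. On the grid of mesh M^-n the weights W are O(M^(-nk)), hence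
   b_T(n) = O(M^-n) and every series converges. *)

Require Import Defs.
From HB Require Import structures.
From mathcomp Require Import all_boot all_order all_algebra.
From mathcomp Require Import all_classical all_reals all_analysis.
From mathcomp Require Import zify ring lra.
Set Implicit Arguments.
Unset Strict Implicit.
Unset Printing Implicit Defensive.
Import Order.TTheory GRing.Theory Num.Theory.
Import numFieldNormedType.Exports.
Local Open Scope classical_set_scope.
Local Open Scope ring_scope.

(** * Inclusion-exclusion for indicators *)

Section FiniteFamilies.

(** The product over [j] of [1 - P j] equals [1 - [exists j, P j]]. Expanding it over subsets gives
    the signed sum, with the empty subset supplying the [1] that cancels. *)
Lemma sum_subsets_sign (R : comPzRingType) (J : finType) (P : pred J) :
  \sum_(T : {set J} | (0 < #|T|)%N)
     (-1) ^+ #|T|.-1 * ([forall j in T, P j])%:R = ([exists j, P j])%:R :> R.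
Proof.
have Pprod (T : {set J}) : ([forall j in T, P j])%:R = \prod_(j in T) (P j)%:R :> R.
  case: (boolP [forall j in T, P j]) => [/forall_inP h|].
    by rewrite big1// => j /h ->.
  rewrite negb_forall_in => /exists_inP[j jT nPj].
  by rewrite (bigD1 j)//= (negbTE nPj) mul0r.
have h1 : \prod_(j : J) (1 - (P j)%:R) = 1 - ([exists j, P j])%:R :> R.
  case: (boolP [exists j, P j]) => [/existsP[j Pj]|].
    by rewrite (bigD1 j)//= Pj subrr mul0r.
  rewrite negb_exists => /forallP h; rewrite subr0 big1// => j _.
  by rewrite (negbTE (h j)) subr0.
have h2 : \prod_(j : J) (1 - (P j)%:R) =
    \sum_(T : {set J}) (-1) ^+ #|T| * ([forall j in T, P j])%:R :> R.
  under eq_bigr => j _ do rewrite addrC.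
  rewrite bigA_distr; apply: eq_bigr => T _.
  rewrite Pprod (bigID (mem T))/= [X in _ * X]big1 ?mulr1; last first.
    by move=> j /negbTE ->.
  rewrite (eq_bigr (fun j => -1 * (P j)%:R)); last first.
    by move=> j ->; rewrite mulN1r.
  by rewrite big_split/= prodr_const.
move: h1; rewrite h2 (bigD1 finset.set0)//= cards0 expr0 mul1r.
have -> : [forall j in (finset.set0 : {set J}), P j].
  by apply/forall_inP => j; rewrite inE.
move/(congr1 (fun x => 1 - x)); rewrite opprB addrCA subrr addr0 => <-.
rewrite opprD addrA subrr add0r -sumrN.
apply: eq_big => [T|T]; first by rewrite card_gt0.
by move=> T0; rewrite -[in RHS](prednK T0) exprS mulN1r mulNr opprK.
Qed.

Lemma bigcap_fin_closed (U : Type) (C : set (set U)) (J : finType)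
    (T : {set J}) (A : J -> set U) :
  (forall X Y, C X -> C Y -> C (X `&` Y)) ->
  (0 < #|T|)%N -> (forall j, j \in T -> C (A j)) ->
  C (\bigcap_(j in [set j | j \in T]) A j).
Proof.
move=> CI /card_gt0P[j0 j0T] CA.
(* One member [A j0] is kept outside the iterated intersection, since the full space, its neutral
   element, need not satisfy [C]. *)
have -> : \bigcap_(j in [set j | j \in T]) A j =
    A j0 `&` \big[setI/setT]_(j in T) A j.
  rewrite -big_enum/= -bigcap_seq; apply/seteqP; split => x /= h.
    split; first exact: h.
    by move=> j /=; rewrite mem_enum => /h.
  by move=> j jT; apply: h.2; rewrite /= mem_enum.
apply: (big_ind (fun X => C (A j0 `&` X))).
- by rewrite setIT; exact: CA.
- by move=> X Y CX CY; rewrite -[A j0]setIid setIACA; exact: CI.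
- by move=> j jT; apply: CI; exact: CA.
Qed.

End FiniteFamilies.

(** * One-dimensional quadrature *)

Section Quadrature.
Context {R : realType}.

(** From the values of an interval's indicator at the nodes, [wl] recovers its length and [wc] its
    Euler characteristic; degenerate intervals are included. *)
Definition quadrature (I : finType) (y wl wc : I -> R) (X : set R) :=
  forall a b, X a -> X b -> a <= b ->
    \sum_t wl t * (a <= y t <= b)%R%:R = b - a /\
    \sum_t wc t * (a <= y t <= b)%R%:R = 1.

Lemma sum_sign_evenint (s t : nat) :
  (s <= t)%N -> \sum_(s.*2 <= h < t.*2.+1) (-1) ^+ h = 1 :> R.
Proof.
elim: t => [|t IH]; rewrite leq_eqVlt => /predU1P[->|].
- by rewrite big_nat1.
- by [].
- by rewrite big_nat1 -signr_odd odd_double.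
- rewrite ltnS => st; rewrite doubleS 2?big_nat_recr//=; try lia.
  by rewrite IH// !exprS; ring.
Qed.

(** Even [h] contribute nothing and odd [h] one full gap, so the sum telescopes. *)
Lemma sum_half_diff (x : nat -> R) (s t : nat) :
  (s <= t)%N -> \sum_(s.*2 <= h < t.*2.+1) (x (uphalf h) - x h./2) = x t - x s.
Proof.
elim: t => [|t IH]; rewrite leq_eqVlt => /predU1P[->|].
- by rewrite big_nat1/= !subrr.
- by [].
- by rewrite big_nat1 uphalf_double doubleK !subrr.
- rewrite ltnS => st; rewrite doubleS 2?big_nat_recr//=; try lia.
  by rewrite IH// !uphalf_double !doubleK; ring.
Qed.

(* The nodes are x_0, (x_0 + x_1)/2, x_1, ..., x_m: the midpoints carry the
   lengths of the gaps, and the alternating signs compute the Euler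
   characteristic. *)
Lemma quadrature_increasing (x : nat -> R) (m : nat) :
  (forall i j, (i < j <= m)%N -> x i < x j) ->
  quadrature (fun h : 'I_m.*2.+1 => (x h./2 + x (uphalf h)) / 2)
    (fun h => x (uphalf h) - x h./2) (fun h => (-1) ^+ h)
    [set z | exists2 i, (i <= m)%N & z = x i].
Proof.
move=> xincr a b [s sm ->] [t tm ->] xst.
have xle i j : (i <= m)%N -> (j <= m)%N -> (x i <= x j) = (i <= j)%N.
  move=> im jm; case: leqP => [|ji].
    rewrite leq_eqVlt => /predU1P[->|ij]; first by rewrite lexx.
    by rewrite ltW// xincr// ij.
  by apply/negbTE; rewrite -ltNge xincr// ji.
have st : (s <= t)%N by rewrite -xle.
(* Even nodes are the points [x u], and a midpoint lies in the interval exactly when its whole gap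
   does; hence the node condition becomes one on indices. *)
have E (h : 'I_m.*2.+1) :
    (x s <= (x h./2 + x (uphalf h)) / 2 <= x t) = (s.*2 <= h < t.*2.+1)%N.
  have hm : (h <= m.*2)%N by rewrite -ltnS.
  have [u [hu|hu]] : exists u, nat_of_ord h = u.*2 \/ nat_of_ord h = u.*2.+1.
    by exists h./2; lia.
  - rewrite hu uphalf_double doubleK.
    have -> : (x u + x u) / 2 = x u by field.
    by rewrite !xle//; lia.
  - rewrite hu /= uphalf_double doubleK.
    have um : (u.+1 <= m)%N by lia.
    have ux : x u < x u.+1 by rewrite xincr//; lia.
    have -> : (x s <= (x u + x u.+1) / 2) = (s <= u)%N.
      have [su|us] := leqP s u.
        have : x s <= x u by rewrite xle//; lia.
        by move=> ?; apply/idP; lra.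
      have : x u.+1 <= x s by rewrite xle//; lia.
      by move=> ?; apply/negbTE; rewrite -ltNge; lra.
    have -> : ((x u + x u.+1) / 2 <= x t) = (u < t)%N.
      have [su|us] := ltnP u t.
        have : x u.+1 <= x t by rewrite xle//; lia.
        by move=> ?; apply/idP; lra.
      have : x t <= x u by rewrite xle//; lia.
      by move=> ?; apply/negbTE; rewrite -ltNge; lra.
    lia.
have F (f : nat -> R) :
    \sum_(h < m.*2.+1) f h * (x s <= (x h./2 + x (uphalf h)) / 2 <= x t)%R%:R =
    \sum_(s.*2 <= h < t.*2.+1) f h.
  under eq_bigr => h _ do rewrite E mulr_natr mulrb.
  rewrite -big_mkcond/= -(big_mkord (fun h => (s.*2 <= h < t.*2.+1)%N)).
  rewrite (big_nat_widen s.*2 t.*2.+1 m.*2.+1)/=; last by lia.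
  by rewrite [RHS](big_nat_widenl _ 0%N)//=; apply: eq_bigl => h; rewrite andbC.
rewrite (F (fun h => x (uphalf h) - x h./2)) (F (fun h => (-1) ^+ h)).
by rewrite sum_half_diff// sum_sign_evenint.
Qed.

Lemma quadrature_sub (I : finType) (y wl wc : I -> R) (X Y : set R) :
  X `<=` Y -> quadrature y wl wc Y -> quadrature y wl wc X.
Proof. by move=> XY q a b /XY aY /XY bY; exact: q. Qed.

Lemma quadrature_seq (s : seq R) :
  exists (I : finType) (y wl wc : I -> R), quadrature y wl wc [set` s].
Proof.
pose u := sort <=%R (undup s).
have us : uniq u by rewrite sort_uniq undup_uniq.
have u_lt : sorted <%R u by rewrite sort_lt_sorted undup_uniq.
(* The last index is [(size u).-1]; for an empty list the single default node is harmless, as there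
   are no endpoints to test. *)
do 4 eexists; apply: quadrature_sub
  (@quadrature_increasing (fun i => nth 0 u i) (size u).-1 _).
- move=> z /= zs; have zu : z \in u by rewrite mem_sort mem_undup.
  exists (index z u); last by rewrite nth_index.
  by move: zu; rewrite -index_mem; case: (size u).
- move=> i j /andP[ij]; case: (posnP (size u)) => [->|u0] ju; first by lia.
  by rewrite lt_sorted_ltn_nth// inE; lia.
Qed.

End Quadrature.

(** * Intrinsic volumes of unions of boxes *)

Section BoxEvaluation.
Context {R : realType} {d : nat}.
Implicit Types (b : pt R d * pt R d) (X : set R) (A B : set (pt R d)).

Lemma Vbox_boxset k b : (forall i, b.1 i <= b.2 i) ->
  Vbox k (boxset b) = Vbox_of k b.
Proof.
move=> le_b; rewrite /Vbox; case: pselect => [h|]; last by case; exists b.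
case: cid => -[lo hi] /= [le_lohi E].
(* A nonempty box determines its endpoints, because each of the two boxes contains both extreme
   corners of the other. *)
have [h1 h2] : boxset b lo /\ boxset b hi.
  by rewrite E; split => i /=; rewrite lexx le_lohi.
have [h3 h4] : boxset (lo, hi) b.1 /\ boxset (lo, hi) b.2.
  by rewrite -E; split => i /=; rewrite lexx le_b.
apply: eq_bigr => S _; apply: eq_bigr => i _ /=.
move: (h1 i) (h2 i) (h3 i) (h4 i) => /=.
by move=> /andP[? ?] /andP[? ?] /andP[? ?] /andP[? ?]; congr (_ - _); lra.
Qed.

Lemma Vbox_set0 k : Vbox k (set0 : set (pt R d)) = 0.
Proof.
rewrite /Vbox; case: pselect => // -[b [le_b E]]; exfalso.
suff : (set0 : set (pt R d)) b.1 by [].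
by rewrite E => i; rewrite lexx le_b.
Qed.

(** The endpoints need not be ordered: empty boxes are allowed, which makes the class closed under
    intersection. *)
Definition gridbox X B :=
  exists b, (forall i, X (b.1 i) /\ X (b.2 i)) /\ B = boxset b.

Definition gridset X A := exists m (f : 'I_m -> set (pt R d)),
  (forall i, gridbox X (f i)) /\ A = \bigcup_(i in [set: 'I_m]) f i.

Lemma gridboxI X B B' : gridbox X B -> gridbox X B' -> gridbox X (B `&` B').
Proof.
move=> [b [bX ->]] [c [cX ->]].
exists (fun i => Num.max (b.1 i) (c.1 i), fun i => Num.min (b.2 i) (c.2 i)).
split=> [i/=|].
  have [[? ?] [? ?]] := (bX i, cX i).
  by split; rewrite ?maxEle ?minEle; case: ifP.
apply/seteqP; split=> x /=.
  move=> [hb hc] i /=; rewrite ge_max le_min.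
  by move: (hb i) (hc i) => /andP[-> ->] /andP[-> ->].
move=> h; split=> i; move: (h i); rewrite /= ge_max le_min.
  by move=> /andP[/andP[-> _] /andP[-> _]].
by move=> /andP[/andP[_ ->] /andP[_ ->]].
Qed.

Lemma gridset_fin X (I : finType) (P : pred I) (f : I -> set (pt R d)) :
  (forall i, P i -> gridbox X (f i)) ->
  gridset X (\bigcup_(i in [set i | P i]) f i).
Proof.
move=> fX; exists #|P|, (fun j => f (enum_val j)); split.
  by move=> j; apply: fX; exact: (enum_valP j).
apply/seteqP; split=> x /=.
  move=> [i /= Pi fx].
  by exists (enum_rank_in (Pi : i \in P) i); rewrite //= enum_rankK_in.
by move=> [j _ fx]; exists (enum_val j) => //=; exact: (enum_valP j).
Qed.

Lemma gridsetI X A B : gridset X A -> gridset X B -> gridset X (A `&` B).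
Proof.
move=> [m [f [fX ->]]] [n [g [gX ->]]].
have -> : \bigcup_(i in [set: 'I_m]) f i `&` \bigcup_(i in [set: 'I_n]) g i =
    \bigcup_(i in [set i : 'I_m * 'I_n | predT i]) (f i.1 `&` g i.2).
  apply/seteqP; split=> x /=.
    by move=> [[i _ fx] [j _ gx]]; exists (i, j).
  by move=> [[i j] _ [fx gx]]; split; [exists i | exists j].
by apply: gridset_fin => -[i j] _; exact: gridboxI.
Qed.

Lemma gridbox_sub X Y B : X `<=` Y -> gridbox X B -> gridbox Y B.
Proof.
move=> XY [b [bX ->]]; exists b; split=> // i.
by have [? ?] := bX i; split; exact: XY.
Qed.

(** * Evaluation of intrinsic volumes at product nodes *)

Section Quad.
Variables (I : finType) (y wl wc : I -> R).

Definition node (h : {ffun 'I_d -> I}) : pt R d := fun i => y (h i).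

(** The [k] directions in [S] are measured by length, the others by Euler characteristic. *)
Definition weight k (h : {ffun 'I_d -> I}) : R :=
  \sum_(S : {set 'I_d} | #|S| == k)
    \prod_i (if i \in S then wl (h i) else wc (h i)).

Definition quad_sum k A : R := \sum_h weight k h * (`[< A (node h) >])%:R.

(** Each side length in the elementary symmetric polynomial is a one-dimensional quadrature, and the
    directions outside [S] are filled with factors 1 given by [wc]. The product of these sums
    expands into a sum over product nodes. *)
Lemma Vbox_quad X k B : quadrature y wl wc X -> gridbox X B ->
  Vbox k B = quad_sum k B.
Proof.
move=> q [b [bX ->]]; rewrite /quad_sum.
have E h : (`[< boxset b (node h) >])%:R =
    \prod_i (b.1 i <= y (h i) <= b.2 i)%R%:R :> R.
  case: asboolP => [hb|nb]; first by rewrite big1// => i _; rewrite hb.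
  have [i hi] : exists i, ~~ (b.1 i <= y (h i) <= b.2 i).
    by apply: contrapT => nh; apply: nb => i; apply: contrapT => hi;
      apply: nh; exists i; exact/negP.
  by rewrite (bigD1 i)//= (negbTE hi) mul0r.
have [le_b|] := pselect (forall i, b.1 i <= b.2 i); last first.
  move=> /existsNP[i /negP hi].
  have b0 : boxset b = set0.
    apply/seteqP; split=> // x /(_ i) /andP[h1 h2].
    by rewrite (le_trans h1 h2) in hi.
  by rewrite b0 Vbox_set0 big1// => h _; rewrite asboolF// mulr0.
rewrite Vbox_boxset// /Vbox_of.
under [RHS]eq_bigr do rewrite E mulr_suml.
rewrite exchange_big/=; apply: eq_bigr => S _.
under [RHS]eq_bigr do rewrite -big_split/=.
rewrite -(bigA_distr_bigA (fun i t => (if i \in S then wl t else wc t) *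
   (b.1 i <= y t <= b.2 i)%R%:R)) [RHS](bigID (mem S))/=.
rewrite [X in _ * X]big1 ?mulr1; last first.
  move=> i /negbTE ->; have [? ?] := bX i.
  by have [] := q _ _ (bX i).1 (bX i).2 (le_b i).
apply: eq_bigr => i iS; rewrite iS.
by have [] := q _ _ (bX i).1 (bX i).2 (le_b i).
Qed.

(** [quad_sum] is linear in the indicator of its set, so the identity reduces to indicators at each
    node. *)
Lemma quad_sum_incl_excl (J : finType) k (f : J -> set (pt R d)) :
  quad_sum k (\bigcup_(i in [set: J]) f i) =
  \sum_(T : {set J} | (0 < #|T|)%N)
    (-1) ^+ #|T|.-1 * quad_sum k (\bigcap_(j in [set j | j \in T]) f j).
Proof.
under [RHS]eq_bigr do rewrite mulr_sumr.
rewrite exchange_big/=; apply: eq_bigr => h _.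
under [RHS]eq_bigr do rewrite mulrCA.
rewrite -mulr_sumr; congr (_ * _).
have -> : `[< (\bigcup_(i in [set: J]) f i) (node h) >] =
    [exists j, `[< f j (node h) >]].
  apply/asboolP/existsP => [[j _ fj]|[j /asboolP fj]]; exists j => //.
  exact/asboolP.
rewrite -sum_subsets_sign; apply: eq_bigr => T _; congr (_ * _%:R).
congr nat_of_bool; apply/forall_inP/asboolP => [hT j jT|hT j jT].
  exact/asboolP/hT.
exact/asboolP/hT.
Qed.

Lemma incl_excl_quad X k m (f : 'I_m -> set (pt R d)) :
  quadrature y wl wc X -> (forall i, gridbox X (f i)) ->
  incl_excl k f = quad_sum k (\bigcup_(i in [set: 'I_m]) f i).
Proof.
move=> q fX; rewrite quad_sum_incl_excl; apply: eq_bigr => S S0.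
congr (_ * _); apply: (Vbox_quad (X := X)) => //.
by apply: bigcap_fin_closed => //; exact: gridboxI.
Qed.

End Quad.

Lemma gridbox_seq m (f : 'I_m -> set (pt R d)) : (forall i, is_box (f i)) ->
  exists s : seq R, forall i, gridbox [set` s] (f i).
Proof.
move=> /choice[b bE].
exists ([seq (b ij.1).1 ij.2 | ij <- enum [set: 'I_m * 'I_d]%SET] ++
        [seq (b ij.1).2 ij.2 | ij <- enum [set: 'I_m * 'I_d]%SET]).
move=> i; exists (b i); split=> // j; split=> /=; rewrite mem_cat.
  by apply/orP; left; apply/mapP; exists (i, j); rewrite ?mem_enum ?inE.
by apply/orP; right; apply/mapP; exists (i, j); rewrite ?mem_enum ?inE.
Qed.

(* Two representations of the same set as a union of boxes are compared on a
   common refinement of their endpoints, where both inclusion-exclusion sums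
   depend only on the union. *)
Lemma Vk_quad (I : finType) (y wl wc : I -> R) X k A :
  quadrature y wl wc X -> gridset X A -> Vk k A = quad_sum y wl wc k A.
Proof.
move=> q [m [f [fX AE]]]; rewrite /Vk; case: pselect => [h|]; last first.
  case; exists (existT _ m f); split => //= i.
  by have [b [_ ->]] := fX i; exists b.
case: cid => -[m' f'] /= [f'box AE'].
have [s' f's'] := gridbox_seq f'box.
have fbox i : is_box (f i) by have [b [_ ->]] := fX i; exists b.
have [s fs] := gridbox_seq fbox.
have [I' [y' [wl' [wc' q']]]] := quadrature_seq (s ++ s').
rewrite (@incl_excl_quad _ _ _ _ _ k m' f' q'); last first.
  move=> i; apply: gridbox_sub (f's' i) => z /= zs.
  by rewrite mem_cat zs orbT.
(* On the common quadrature the sum for [f'] depends only on the union, so it is also the sum for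
   [f], which [q] then evaluates. *)
rewrite -AE' AE -(incl_excl_quad _ q' (f := f)); last first.
  by move=> i; apply: gridbox_sub (fs i) => z /= zs; rewrite mem_cat zs.
exact: incl_excl_quad q fX.
Qed.

End BoxEvaluation.

(** * Bernoulli bits *)

Section BernoulliPushforward.

Lemma big_codom (R : Type) (idx : R) (op : Monoid.com_law idx) (A B : finType)
    (e : A -> B) (G : B -> R) : injective e ->
  \big[op/idx]_(b in codom e) G b = \big[op/idx]_a G (e a).
Proof.
move=> e_inj; rewrite -big_uniq/=; last by rewrite map_inj_uniq ?enum_uniq.
by rewrite big_map big_enum.
Qed.

(** For fixed values [u] of the bits seen through [e], the bits in the image are prescribed and
    every other bit runs over both values, so the sum factorizes. *)
Lemma sum_bits_pushforward (R : comPzSemiRingType) (A B : finType) (e : A -> B)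
    (F : B -> bool -> R) (X : {ffun A -> bool} -> R) : injective e ->
  \sum_(w : {ffun B -> bool}) (\prod_b F b (w b)) * X [ffun a => w (e a)] =
  (\prod_(b | b \notin codom e) (F b true + F b false)) *
  \sum_(u : {ffun A -> bool}) (\prod_a F (e a) (u a)) * X u.
Proof.
move=> e_inj; rewrite mulr_sumr.
rewrite (partition_big (fun w : {ffun B -> bool} => [ffun a => w (e a)]) predT)//=.
apply: eq_bigr => u _.
pose Q b v := [forall a, (e a == b) ==> (u a == v)].
rewrite (eq_bigr (fun w : {ffun B -> bool} => (\prod_b F b (w b)) * X u));
  last by move=> w /eqP ->.
rewrite -mulr_suml mulrA; congr (_ * _).
rewrite (eq_bigl (fun w => w \in family Q)); last first.
  move=> w; apply/eqP/familyP => [uE b|h].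
    by apply/forallP => a; apply/implyP => /eqP <-; rewrite -uE ffunE.
  apply/ffunP => a; rewrite ffunE; apply/eqP; rewrite eq_sym.
  by have /forallP/(_ a) := h (e a); rewrite eqxx.
rewrite -(bigA_distr_big_dep Q F) (bigID (mem (codom e)))/= mulrC.
congr (_ * _).
  apply: eq_bigr => b bNe.
  rewrite (eq_bigl predT); last first.
    move=> v; apply/forallP => a; apply/implyP => /eqP eab.
    by rewrite -eab codom_f in bNe.
  by rewrite big_bool.
rewrite big_codom//; apply: eq_bigr => a _.
rewrite (eq_bigl (pred1 (u a))) ?big_pred1_eq// => v.
apply/forallP/eqP => [/(_ a)|-> a']; first by rewrite eqxx => /eqP.
by apply/implyP => /eqP/e_inj ->.
Qed.

End BernoulliPushforward.

(** * Expectations and independence of bits *)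

Section Expectation.
Context {R : realType} {d M n : nat}.
Implicit Types (p : R) (X Y : config d M n -> R).

Lemma eq_Exp p X Y : X =1 Y -> Exp p X = Exp p Y.
Proof. by move=> XY; apply: eq_bigr => w _; rewrite XY. Qed.

Lemma ExpZ p (c : R) X : Exp p (fun w => c * X w) = c * Exp p X.
Proof. by rewrite /Exp mulr_sumr; apply: eq_bigr => w _; rewrite mulrCA. Qed.

Lemma Exp_sum p (I : finType) (P : pred I) (X : I -> config d M n -> R) :
  Exp p (fun w => \sum_(i | P i) X i w) = \sum_(i | P i) Exp p (X i).
Proof. by rewrite /Exp exchange_big/=; apply: eq_bigr => w _; rewrite mulr_sumr. Qed.

Lemma prob_ge0 p (w : config d M n) : 0 <= p <= 1 -> 0 <= prob p w.
Proof.
by move=> /andP[p0 p1]; apply: prodr_ge0 => x _; case: ifP; rewrite // subr_ge0.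
Qed.

Lemma le_Exp p X Y : 0 <= p <= 1 -> (forall w, X w <= Y w) ->
  Exp p X <= Exp p Y.
Proof.
by move=> p01 XY; apply: ler_sum => w _; apply: ler_wpM2l; rewrite ?prob_ge0.
Qed.

Lemma ler_norm_Exp p X : 0 <= p <= 1 -> `|Exp p X| <= Exp p (fun w => `|X w|).
Proof.
move=> p01; apply: le_trans (ler_norm_sum _ _ _) _; apply: ler_sum => w _.
by rewrite normrM (ger0_norm (prob_ge0 _ _)).
Qed.

Lemma Exp_pushforward p (A : finType) (e : A -> 'I_n * cidx d M n)
    (Y : {ffun A -> bool} -> R) : injective e ->
  Exp p (fun w => Y [ffun a => w (e a)]) =
  \sum_(u : {ffun A -> bool}) (\prod_a (if u a then p else 1 - p)) * Y u.
Proof.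
move=> e_inj; rewrite /Exp /prob.
rewrite (sum_bits_pushforward (fun=> fun v : bool => if v then p else 1 - p))//.
by rewrite big1 ?mul1r// => b _; rewrite addrC subrK.
Qed.

Lemma Exp_bit_pushforward p (A : finType) (e : A -> 'I_n * cidx d M n)
    (x : 'I_n * cidx d M n) (Y : {ffun A -> bool} -> R) :
  injective e -> x \notin codom e ->
  Exp p (fun w => (w x)%:R * Y [ffun a => w (e a)]) =
  p * \sum_(u : {ffun A -> bool}) (\prod_a (if u a then p else 1 - p)) * Y u.
Proof.
move=> e_inj xNe; rewrite /Exp /prob.
(* The factor [w x] is absorbed into the weight of the bit [x]; summing that bit out gives [p], and
   any other unseen bit gives 1. *)
pose F b (v : bool) := (if v then p else 1 - p) * (if b == x then v%:R else 1).
transitivity (\sum_(w : config d M n)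
    (\prod_b F b (w b)) * Y [ffun a => w (e a)]).
  apply: eq_bigr => w _; rewrite big_split/= mulrA; congr (_ * _ * _).
  by rewrite (bigD1 x)//= eqxx big1 ?mulr1// => i /negbTE ->.
rewrite (sum_bits_pushforward F)//; congr (_ * _).
  rewrite (bigD1 x)//= big1 ?mulr1 /F ?eqxx ?mulr0 ?addr0 ?mulr1// => b.
  by move=> /andP[_ /negbTE ->]; rewrite !mulr1 addrC subrK.
apply: eq_bigr => u _; congr (_ * _); apply: eq_bigr => a _.
rewrite /F; have /negbTE -> : e a != x; last by rewrite mulr1.
by apply: contraNneq xNe => <-; exact: codom_f.
Qed.

Lemma Exp_kept p (c : cidx d M n) : Exp p (fun w => (kept w c)%:R) = p ^+ n.
Proof.
(* Survival of [c] depends on one bit per level, hence on [n] distinct bits that must all be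
   true. *)
pose e (l : 'I_n) := (l, anc l.+1 c).
have e_inj : injective e by move=> l l' [].
rewrite (eq_Exp p (Y := fun w => [forall l, [ffun a => w (e a)] l]%:R)); last first.
  by move=> w; congr (nat_of_bool _)%:R; apply: eq_forallb => l; rewrite ffunE.
rewrite (Exp_pushforward p (fun u : {ffun 'I_n -> bool} => [forall l, u l]%:R))//.
rewrite (bigD1 [ffun=> true])//= [X in _ + X]big1 ?addr0.
  rewrite (_ : [forall l, _] = true) ?mulr1; last by apply/forallP => l; rewrite ffunE.
  by under eq_bigr do rewrite ffunE; rewrite prodr_const card_ord.
move=> u nu; rewrite (_ : [forall l, _] = false) ?mulr0//.
apply/negbTE; apply: contraNN nu => /forallP h.
by apply/eqP/ffunP => l; rewrite ffunE h.
Qed.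

End Expectation.

(** * The percolation inside a level-1 cube *)

Section SelfSimilarity.
Context {d M n : nat}.
Variable j : {ffun 'I_d -> 'I_M}.

Lemma subcube_subproof (l : nat) (c : cidx d M n) (i : 'I_d) :
  (j i * M ^ minn l n + c i < M ^ n.+1)%N.
Proof.
have M0 : (0 < M)%N by apply: leq_ltn_trans (ltn_ord (j i)).
have : (M ^ minn l n <= M ^ n)%N by rewrite leq_pexp2l// geq_minr.
have := ltn_ord (j i); have := ltn_ord (c i); rewrite expnS; nia.
Qed.

(* For [l <= n], the index of the level-[l+1] cube that sits in the level-1
   cube [j] as the level-[l] cube [c] sits in the unit cube; only [c i < M ^ l]
   is meaningful, the other indices are carried along injectively. *)
Definition subcube (l : nat) (c : cidx d M n) : cidx d M n.+1 :=
  [ffun i => Ordinal (subcube_subproof l c i)].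

Lemma root_subproof (i : 'I_d) : (j i < M ^ n.+1)%N.
Proof.
have M0 : (0 < M)%N by apply: leq_ltn_trans (ltn_ord (j i)).
by apply: leq_trans (ltn_ord (j i)) _; rewrite -[leqLHS]expn1 leq_pexp2l.
Qed.

(** This bit decides whether the level-1 cube [j] itself is kept. *)
Definition root_bit : 'I_n.+1 * cidx d M n.+1 :=
  (ord0, [ffun i => Ordinal (root_subproof i)]).

(** A bit with first component [l] concerns level [l+1], hence the shift by [a.1.+1]; inside [j]
    that cube has level [l+2]. *)
Definition sub_bit (a : 'I_n * cidx d M n) : 'I_n.+1 * cidx d M n.+1 :=
  (lift ord0 a.1, subcube a.1.+1 a.2).

Definition sub_config (w : config d M n.+1) : config d M n :=
  [ffun a => w (sub_bit a)].

Lemma subcube_inj l : injective (subcube l).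
Proof.
move=> c c' /ffunP h; apply/ffunP => i; apply/val_inj.
by have := congr1 val (h i); rewrite !ffunE/= => /addnI.
Qed.

Lemma sub_bit_inj : injective sub_bit.
Proof. by move=> [l c] [l' c'] [/val_inj ll']; subst l' => /subcube_inj ->. Qed.

Lemma root_bit_notin : root_bit \notin codom sub_bit.
Proof. by apply/codomP => -[[l c]] []. Qed.

(** The bit of [j] is independent of the bits strictly inside [j], which form a percolation with [n]
    steps. *)
Lemma Exp_sub_config (R : realType) (p : R) (X : config d M n -> R) :
  Exp p (fun w => (w root_bit)%:R * X (sub_config w)) = p * Exp p X.
Proof. exact: Exp_bit_pushforward sub_bit_inj root_bit_notin. Qed.

(** The level-1 ancestor of the embedded cube is [j], and its deeper ancestors are the embedded
    ancestors of [c]. *)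
Lemma kept_subcube (w : config d M n.+1) (c : cidx d M n) :
  kept w (subcube n c) = w root_bit && kept (sub_config w) c.
Proof.
have anc0 : ((ord0 : 'I_n.+1), anc 1 (subcube n c)) = root_bit.
  congr pair; apply/ffunP => i; apply/val_inj; rewrite !ffunE/= minnn subn1/=.
  have M0 : (0 < M ^ n)%N by apply: leq_ltn_trans (ltn_ord (c i)).
  by rewrite divnMDl// divn_small// addn0.
have ancS (l : 'I_n) : (lift ord0 l, anc (lift ord0 l).+1 (subcube n c)) =
    sub_bit (l, anc l.+1 c).
  congr pair; apply/ffunP => i; apply/val_inj; rewrite !ffunE/= minnn.
  have ln : (l.+1 <= n)%N by [].
  rewrite (minn_idPl ln) /bump/= add1n subSS.
  have M0 : (0 < M)%N by apply: leq_ltn_trans (ltn_ord (j i)).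
  by rewrite -{1}(subnK ln) expnD mulnA mulnAC divnMDl ?expn_gt0 ?M0// ffunE.
apply/forallP/andP => [h|[h0 /forallP h] l].
  split; first by rewrite -anc0; exact: (h ord0).
  by apply/forallP => l; rewrite ffunE -ancS.
case: (unliftP ord0 l) => [l' ->|->]; last by rewrite anc0.
by have := h l'; rewrite ffunE -ancS.
Qed.

Lemma subcube_div (c : cidx d M n) (i : 'I_d) : (subcube n c i %/ M ^ n)%N = j i.
Proof.
have M0 : (0 < M ^ n)%N by apply: leq_ltn_trans (ltn_ord (c i)).
by rewrite ffunE/= minnn divnMDl// divn_small// addn0.
Qed.

Lemma subcube_surj (c : cidx d M n.+1) :
  (forall i, (c i %/ M ^ n)%N = j i) -> exists c', c = subcube n c'.
Proof.
move=> h.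
have M0 (i : 'I_d) : (0 < M ^ n)%N.
  have M0 : (0 < M)%N by apply: leq_ltn_trans (ltn_ord (j i)).
  by rewrite expn_gt0 M0.
exists [ffun i => Ordinal (ltn_pmod (c i) (M0 i))].
apply/ffunP => i; apply/val_inj; rewrite !ffunE/= minnn -h.
by rewrite ffunE; exact: divn_eq.
Qed.

End SelfSimilarity.

(** * The M-adic grid *)

Section GridEvaluation.
Context {R : realType} {d M : nat}.
Hypothesis M_gt0 : (0 < M)%N.

Local Lemma Mn_gt0 n : (0 < M ^ n)%N. Proof. by rewrite expn_gt0 M_gt0. Qed.

Local Lemma MnR_gt0 n : 0 < (M ^ n)%:R :> R.
Proof. by rewrite ltr0n Mn_gt0. Qed.

Definition gridpt n (i : nat) : R := i%:R / (M ^ n)%:R.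

Definition gridpts n : set R := [set z | exists2 i, (i <= M ^ n)%N & z = gridpt n i].

(* [h] stands for the point with coordinates [h i / (2 * M ^ n)]: even
   coordinates are grid points, odd ones are midpoints. *)
Definition halfgrid n := {ffun 'I_d -> 'I_(M ^ n).*2.+1}.

Definition grid_node n (h : 'I_(M ^ n).*2.+1) : R :=
  (gridpt n h./2 + gridpt n (uphalf h)) / 2.

Definition grid_wl n (h : 'I_(M ^ n).*2.+1) : R :=
  gridpt n (uphalf h) - gridpt n h./2.

Definition grid_wc n (h : 'I_(M ^ n).*2.+1) : R := (-1) ^+ h.

Definition grid_weight n k (h : halfgrid n) : R :=
  weight (@grid_wl n) (@grid_wc n) k h.

Lemma grid_quadrature n :
  quadrature (@grid_node n) (@grid_wl n) (@grid_wc n) (gridpts n).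
Proof.
apply: quadrature_increasing => i j /andP[ij _].
by rewrite /gridpt ltr_pM2r ?invr_gt0 ?MnR_gt0// ltr_nat.
Qed.

Lemma grid_nodeE n h : @grid_node n h = h%:R / 2 / (M ^ n)%:R.
Proof.
have hE : (h./2 + uphalf h = h)%N by rewrite uphalf_half; lia.
rewrite /grid_node /gridpt -mulrDl -natrD hE.
by rewrite mulrAC.
Qed.

Lemma grid_wlE n h : @grid_wl n h = (odd h)%:R / (M ^ n)%:R.
Proof. by rewrite /grid_wl /gridpt -mulrBl uphalf_half natrD addrK. Qed.

Definition incube (c h : 'I_d -> nat) : bool :=
  [forall i, (2 * c i <= h i <= 2 * c i + 2)%N].

Lemma cubeset_node n (c : 'I_d -> nat) (h : halfgrid n) :
  cubeset M n c (node (@grid_node n) h) <-> incube c (fun i => h i).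
Proof.
have E i : ((c i)%:R / (M ^ n)%:R <= grid_node (h i) <= (c i).+1%:R / (M ^ n)%:R)
    = (2 * c i <= h i <= 2 * c i + 2)%N.
  rewrite grid_nodeE !ler_pM2r ?invr_gt0 ?MnR_gt0//.
  rewrite ler_pdivlMr// ler_pdivrMr// -!natrM !ler_nat; lia.
split=> [h1|/forallP h1 i]; last by rewrite /node E.
by apply/forallP => i; rewrite -E; exact: h1.
Qed.

Lemma gridbox_cubeset n (c : cidx d M n) :
  gridbox (gridpts n) (cubeset M n (fun i => c i) : set (pt R d)).
Proof.
exists (fun i => gridpt n (c i), fun i => gridpt n (c i).+1); split=> // i /=.
split; last by exists (c i).+1.
by exists (c i) => //; exact: ltnW.
Qed.

Lemma gridset_cubes n (P : pred (cidx d M n)) :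
  gridset (gridpts n)
    (\bigcup_(c in [set c | P c]) cubeset M n (fun i => c i) : set (pt R d)).
Proof. by apply: gridset_fin => c _; exact: gridbox_cubeset. Qed.

Lemma asbool_cubes n (P : pred (cidx d M n)) (h : halfgrid n) :
  `[< (\bigcup_(c in [set c | P c]) cubeset M n (fun i => c i))
      (node (@grid_node n) h) >] =
  [exists c, P c && incube (fun i => c i) (fun i => h i)].
Proof.
apply/asboolP/existsP => [[c /= Pc /cubeset_node ch]|[c /andP[Pc ch]]].
  by exists c; rewrite Pc.
by exists c => //; exact/cubeset_node.
Qed.

(** Containment is tested on the two extreme corners, which turns it into a division of indices. *)
Lemma cubeset_sub_level1 n (c : cidx d M n.+1) (j : {ffun 'I_d -> 'I_M}) :
  (cubeset M n.+1 (fun i => c i) : set (pt R d)) `<=` cubeset M 1 (fun i => j i) <->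
  [forall i, (c i %/ M ^ n == j i)%N].
Proof.
have E (a b : nat) : (a%:R / (M ^ 1)%:R <= b%:R / (M ^ n.+1)%:R :> R) =
    (a * M ^ n <= b)%N.
  rewrite ler_pdivrMr ?MnR_gt0// mulrAC ler_pdivlMr ?MnR_gt0//.
  by rewrite -!natrM ler_nat expn1 expnS mulnCA mulnC leq_pmul2r.
have E' (a b : nat) : (b%:R / (M ^ n.+1)%:R <= a%:R / (M ^ 1)%:R :> R) =
    (b <= a * M ^ n)%N.
  rewrite ler_pdivlMr ?MnR_gt0// mulrAC ler_pdivrMr ?MnR_gt0//.
  by rewrite -!natrM ler_nat expn1 expnS mulnCA [leqRHS]mulnC leq_pmul2r.
have le_c i : (c i)%:R / (M ^ n.+1)%:R <= (c i).+1%:R / (M ^ n.+1)%:R :> R.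
  by rewrite ler_pM2r ?invr_gt0 ?MnR_gt0// ler_nat.
split=> [sub|/forallP cj x cx i].
  apply/forallP => i.
  have /sub/(_ i)/andP[+ _] : cubeset M n.+1 (fun i => c i)
      (fun i => (c i)%:R / (M ^ n.+1)%:R : R).
    by move=> i'; rewrite lexx le_c.
  have /sub/(_ i)/andP[_] : cubeset M n.+1 (fun i => c i)
      (fun i => (c i).+1%:R / (M ^ n.+1)%:R : R).
    by move=> i'; rewrite lexx le_c.
  rewrite E E' => h1 h2; rewrite eqn_leq leq_divRL ?Mn_gt0// h2 andbT.
  by rewrite -ltnS ltn_divLR ?Mn_gt0.
have /eqP ci := cj i; have /andP[h1 h2] := cx i.
apply/andP; split.
  by apply: le_trans h1; rewrite E -ci leq_divM.
by apply: le_trans h2 _; rewrite E' -ci ltn_ceil ?Mn_gt0.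
Qed.

Definition in_level1 n (j : {ffun 'I_d -> 'I_M}) (c : cidx d M n.+1) : bool :=
  [forall i, (c i %/ M ^ n == j i)%N].

Lemma FnjE n (j : {ffun 'I_d -> 'I_M}) (w : config d M n.+1) :
  (Fnj j w : set (pt R d)) =
  \bigcup_(c in [set c | kept w c && in_level1 j c]) cubeset M n.+1 (fun i => c i).
Proof.
congr (bigcup _ _); apply/seteqP; split=> c /=.
  by move=> [-> /cubeset_sub_level1].
by move=> /andP[-> /cubeset_sub_level1].
Qed.

Lemma Fn_bigcup n (w : config d M n.+1) :
  (Fn w : set (pt R d)) = \bigcup_(j in [set: {ffun 'I_d -> 'I_M}]) Fnj j w.
Proof.
apply/seteqP; split=> x.
  move=> [c /= kc cx].
  have cM i : (c i %/ M ^ n < M)%N.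
    by rewrite ltn_divLR ?Mn_gt0// -expnS.
  exists [ffun i => Ordinal (cM i)] => //; rewrite FnjE; exists c => //=.
  by rewrite kc; apply/forallP => i; rewrite ffunE.
by move=> [j _]; rewrite FnjE => -[c /= /andP[kc _] cx]; exists c.
Qed.

(** Combinatorial form of the membership of the half-grid point [h] in [Fn w]. *)
Definition hit n (w : config d M n) (h : halfgrid n) : bool :=
  [exists c, kept w c && incube (fun i => c i) (fun i => h i)].

Definition hit_in n j (w : config d M n.+1) (h : halfgrid n.+1) : bool :=
  [exists c, kept w c && in_level1 j c && incube (fun i => c i) (fun i => h i)].

Lemma Vk_Fn n k (w : config d M n) :
  Vk k (Fn w : set (pt R d)) = \sum_h grid_weight k h * (hit w h)%:R.
Proof.
rewrite (Vk_quad _ (@grid_quadrature n) (gridset_cubes _)).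
by apply: eq_bigr => h _; rewrite asbool_cubes.
Qed.

Lemma gridset_Fnj n j (w : config d M n.+1) :
  gridset (gridpts n.+1) (Fnj j w : set (pt R d)).
Proof. by rewrite FnjE; exact: gridset_cubes. Qed.

Lemma Vk_Fnj n k j (w : config d M n.+1) :
  Vk k (Fnj j w : set (pt R d)) = \sum_h grid_weight k h * (hit_in j w h)%:R.
Proof.
rewrite (Vk_quad _ (@grid_quadrature n.+1) (gridset_Fnj _ _)).
by apply: eq_bigr => h _; rewrite FnjE asbool_cubes.
Qed.

Lemma Vk_bigcap_Fnj n k (T : {set {ffun 'I_d -> 'I_M}}) (w : config d M n.+1) :
  (0 < #|T|)%N ->
  Vk k (\bigcap_(j in [set j | j \in T]) Fnj j w : set (pt R d)) =
  \sum_h grid_weight k h * ([forall j in T, hit_in j w h])%:R.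
Proof.
move=> T0; rewrite (Vk_quad _ (@grid_quadrature n.+1)); last first.
  apply: bigcap_fin_closed => // [X Y|j _]; first exact: gridsetI.
  exact: gridset_Fnj.
apply: eq_bigr => h _; congr (_ * (nat_of_bool _)%:R).
apply/asboolP/forall_inP => hT j jT; have := hT j jT; rewrite FnjE.
  by move=> /asboolP; rewrite asbool_cubes.
by move=> hj; apply/asboolP; rewrite asbool_cubes.
Qed.

Lemma Vk_incl_excl n k (w : config d M n.+1) :
  Vk k (Fn w : set (pt R d)) =
  \sum_(T : {set {ffun 'I_d -> 'I_M}} | (0 < #|T|)%N)
    (-1) ^+ #|T|.-1 * Vk k (\bigcap_(j in [set j | j \in T]) Fnj j w : set (pt R d)).
Proof.
rewrite (Vk_quad _ (@grid_quadrature n.+1) (gridset_cubes _)) -/(Fn w).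
rewrite Fn_bigcup quad_sum_incl_excl; apply: eq_bigr => T T0; congr (_ * _).
rewrite (Vk_quad _ (@grid_quadrature n.+1))//.
apply: bigcap_fin_closed => // [X Y|j _]; first exact: gridsetI.
exact: gridset_Fnj.
Qed.

End GridEvaluation.

Arguments halfgrid : clear implicits.

(** * Self-similarity and intersections of parts *)

Section GridSelfSimilarity.
Context {d M n : nat}.
Variable j : {ffun 'I_d -> 'I_M}.

Lemma shift_subproof (h : halfgrid d M n) (i : 'I_d) :
  (h i + 2 * (j i * M ^ n) < (M ^ n.+1).*2.+1)%N.
Proof.
move: (ltn_ord (h i)) (ltn_ord (j i)); move: (nat_of_ord (h i)) => u.
by rewrite expnS -!addnn; nia.
Qed.

Definition shift (h : halfgrid d M n) : halfgrid d M n.+1 :=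
  [ffun i => Ordinal (shift_subproof h i)].

Lemma shift_inj : injective shift.
Proof.
move=> h h' /ffunP E; apply/ffunP => i; apply/val_inj.
by have := congr1 val (E i); rewrite !ffunE/= => /addIn.
Qed.

Lemma incube_shift (c : cidx d M n) (h : halfgrid d M n) :
  incube (fun i => subcube j n c i) (fun i => shift h i) =
  incube (fun i => c i) (fun i => h i).
Proof. by apply: eq_forallb => i; rewrite !ffunE/= minnn; lia. Qed.

Lemma hit_in_shift (w : config d M n.+1) (h : halfgrid d M n) :
  hit_in j w (shift h) = w (root_bit j) && hit (sub_config j w) h.
Proof.
apply/existsP/andP => [[c /andP[/andP[kc cj] ch]]|[wr /existsP[c /andP[kc ch]]]].
  have [c' cE] : exists c', c = subcube j n c'.
    by apply: subcube_surj => i; apply/eqP; move/forallP: cj; exact.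
  move: kc ch; rewrite cE kept_subcube incube_shift => /andP[-> kc'] ch.
  by split=> //; apply/existsP; exists c'; rewrite kc' ch.
exists (subcube j n c); rewrite kept_subcube incube_shift wr kc ch /= andbT.
by apply/forallP => i; rewrite subcube_div.
Qed.

Lemma hit_in_range (w : config d M n.+1) (h : halfgrid d M n.+1) (i : 'I_d) :
  hit_in j w h -> (2 * (j i * M ^ n) <= h i <= 2 * (j i * M ^ n) + 2 * M ^ n)%N.
Proof.
move=> /existsP[c /andP[/andP[_ /forallP/(_ i)/eqP cj] /forallP/(_ i)]].
have M0 : (0 < M ^ n)%N.
  by rewrite expn_gt0 (leq_ltn_trans _ (ltn_ord (j i))).
have := divn_eq (c i) (M ^ n); rewrite cj.
by have := ltn_pmod (c i) M0; lia.
Qed.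

Lemma hit_in_codom (w : config d M n.+1) (h : halfgrid d M n.+1) :
  hit_in j w h -> h \in codom shift.
Proof.
move=> hj.
have lt_h i : (h i - 2 * (j i * M ^ n) < (M ^ n).*2.+1)%N.
  by have := hit_in_range i hj; lia.
apply/codomP; exists [ffun i => Ordinal (lt_h i)]; apply/ffunP => i.
apply/val_inj; rewrite !ffunE/= ffunE/= subnK//.
by have /andP[] := hit_in_range i hj.
Qed.

(** Homogeneity of degree [k]: each of the [k] length weights shrinks by [M], while the shift is
    even and so preserves parities and signs. *)
Lemma grid_weight_shift (R : realType) k (h : halfgrid d M n) :
  grid_weight k (shift h) = (M%:R : R) ^- k * grid_weight k h.
Proof.
rewrite /grid_weight /weight mulr_sumr; apply: eq_bigr => S /eqP Sk.
have -> : (M%:R : R) ^- k = \prod_i (if i \in S then M%:R^-1 else 1).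
  by rewrite -big_mkcond/= prodr_const Sk exprVn.
have M0 (i : 'I_d) : (0 < M)%N by apply: leq_ltn_trans (ltn_ord (j i)).
rewrite -big_split; apply: eq_bigr => i _ /=; case: ifP => _.
  rewrite !grid_wlE ?(M0 i)// ffunE/= oddD oddM/= addbF expnS natrM invfM.
  by rewrite mulrCA.
by rewrite mul1r /grid_wc ffunE/= -[LHS]signr_odd -[RHS]signr_odd oddD oddM/= addbF.
Qed.

(** Only positions in the image of [shift] can be hit by the part in [j], and there both the weights
    and the hits are those of the rescaled percolation. *)
Lemma Vk_Fnj_sub_config (R : realType) k (w : config d M n.+1) : (0 < M)%N ->
  Vk k (Fnj j w : set (pt R d)) = M%:R ^- k *
    ((w (root_bit j))%:R * Vk k (Fn (sub_config j w) : set (pt R d))).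
Proof.
move=> M0; rewrite Vk_Fnj// Vk_Fn// !mulr_sumr.
rewrite (bigID (mem (codom shift)))/= [X in _ + X]big1 ?addr0; last first.
  move=> h; case: (boolP (hit_in j w h)) => [/hit_in_codom ->//|_ _].
  by rewrite mulr0.
rewrite big_codom; last exact: shift_inj.
apply: eq_bigr => h _.
by rewrite grid_weight_shift hit_in_shift -mulnb natrM; ring.
Qed.

Lemma Exp_Vk_Fnj (R : realType) (p : R) k : (0 < M)%N ->
  Exp p (fun w : config d M n.+1 => Vk k (Fnj j w : set (pt R d))) =
  M%:R ^- k * p * Exp p (fun w : config d M n => Vk k (Fn w : set (pt R d))).
Proof.
move=> M0; under eq_Exp do rewrite Vk_Fnj_sub_config//.
by rewrite ExpZ (Exp_sub_config j p (fun w => Vk k (Fn w))) mulrA.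
Qed.

End GridSelfSimilarity.

(** * Counting cubes along a common face *)

Section IntersectionBound.

Lemma sum_eq_nat_le1 N a : (\sum_(t < N) (t == a :> nat) <= 1)%N.
Proof.
have -> : (\sum_(t < N) (t == a :> nat) = #|[pred t : 'I_N | t == a :> nat]|)%N.
  rewrite -sum1_card [RHS]big_mkcond; apply: eq_bigr => t _.
  by rewrite inE; case: eqP.
apply/card_le1_eqP => s t; rewrite !inE => /eqP sa /eqP ta.
by apply/val_inj; rewrite /= sa ta.
Qed.

Lemma sum_incube1_le2 N u : (\sum_(t < N) (2 * t <= u <= 2 * t + 2) <= 2)%N.
Proof.
apply: (@leq_trans (\sum_(t < N) ((t == u./2 :> nat) + (t == u./2.-1 :> nat)))).
  apply: leq_sum => t _.
  case: (boolP (2 * t <= u <= 2 * t + 2)%N) => // tu.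
  have : (t == u./2 :> nat) || (t == u./2.-1 :> nat) by lia.
  by case/orP => ->; rewrite ?addn1.
by rewrite big_split; apply: (@leq_add _ _ 1 1); exact: sum_eq_nat_le1.
Qed.

Lemma sum_incube_slab (d M n : nat) (i0 : 'I_d) (v : nat) : (0 < M)%N ->
  (\sum_(h : halfgrid d M n | h i0 == v :> nat) \sum_(c : cidx d M n)
     incube (fun i => c i) (fun i => h i) <= 6 ^ d * (M ^ n) ^ d.-1)%N.
Proof.
move=> M0; have N0 : (0 < M ^ n)%N by rewrite expn_gt0 M0.
pose g i (u : 'I_(M ^ n).*2.+1) := (((i == i0) ==> (u == v :> nat)) *
  \sum_(t < M ^ n) (2 * t <= u <= 2 * t + 2))%N.
(* The count factorizes over coordinates: [i0] gives at most 2, every other coordinate at most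
   [2 (2 M^n + 1) <= 6 M^n]. *)
have -> : (\sum_(h : halfgrid d M n | h i0 == v :> nat) \sum_(c : cidx d M n)
    incube (fun i => c i) (fun i => h i) = \prod_i \sum_u g i u)%N.
  rewrite bigA_distr_bigA big_mkcond/=; apply: eq_bigr => h _.
  rewrite /g big_split/= bigA_distr_bigA/=.
  have -> : (\prod_i ((i == i0) ==> (h i == v :> nat)) = (h i0 == v :> nat))%N.
    rewrite (bigD1 i0)//= eqxx/= big1 ?muln1// => i /negbTE ->//.
  case: eqP => _; rewrite ?mul0n// mul1n; apply: eq_bigr => c _.
  case: (boolP (incube _ _)) => [/forallP H|].
    by rewrite big1// => i _; rewrite H.
  rewrite negb_forall => /existsP[i /negbTE Hi].
  by rewrite (bigD1 i)//= Hi mul0n.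
have g2 i u : (g i u <= 2)%N.
  by rewrite /g; apply: (@leq_mul _ _ 1 2); [case: (_ ==> _) | exact: sum_incube1_le2].
rewrite (bigD1 i0)//=.
have -> : (6 ^ d * (M ^ n) ^ d.-1 = 6 * \prod_(i < d | i != i0) (6 * M ^ n))%N.
  rewrite prod_nat_const (_ : #|_| = d.-1); last by rewrite cardC1 card_ord.
  case: d i0 {g g2} => [[]//|d' _] /=; by rewrite expnMn expnS mulnA.
apply: leq_mul.
  apply: (@leq_trans (\sum_(u < (M ^ n).*2.+1) 2 * (u == v :> nat))).
    apply: leq_sum => u _; rewrite /g eqxx/=; case: eqP => _ //.
    by rewrite mul1n muln1 sum_incube1_le2.
  rewrite -big_distrr/=; apply: (@leq_trans (2 * 1)) => //.
  by rewrite leq_mul2l sum_eq_nat_le1.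
apply: leq_prod => i _; apply: (leq_trans (leq_sum _ (fun u _ => g2 i u))).
by rewrite sum_nat_const card_ord -addnn; lia.
Qed.

(** There are ['C(d, k)] direction sets; each has [k] length weights of size at most [M^-n] and
    otherwise signs. *)
Lemma norm_grid_weight (R : realType) (d M n k : nat) (h : halfgrid d M n) :
  (0 < M)%N -> `|grid_weight k h : R| <= 'C(d, k)%:R * (M ^ n)%:R ^- k.
Proof.
move=> M0; apply: le_trans (ler_norm_sum _ _ _) _.
apply: (@le_trans _ _ (\sum_(S : {set 'I_d} | #|S| == k) (M ^ n)%:R ^- k)).
  apply: ler_sum => S /eqP Sk; rewrite normr_prod.
  have -> : ((M ^ n)%:R : R) ^- k =
      \prod_i (if i \in S then (M ^ n)%:R^-1 else 1).
    by rewrite -big_mkcond/= prodr_const Sk exprVn.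
  apply: ler_prod => i _; rewrite normr_ge0/=; case: ifP => _.
    rewrite grid_wlE// normrM normfV !ger0_norm// ler_piMl ?invr_ge0//.
    by case: odd.
  by rewrite /grid_wc normrX normrN1 expr1n.
rewrite sumr_const -[X in X <= _]mulr_natl.
by rewrite -[d in 'C(d, _)]card_ord -card_draws cardsE.
Qed.

(* The intersection is carried by the common face of two distinct level-1
   cubes, which meets O(M^(n(d-1))) half-grid positions and O(M^(n(d-1)))
   cubes; each cube survives with probability p^n. *)
Lemma norm_Exp_Vk_bigcap (R : realType) (d M n k : nat) (p : R)
    (T : {set {ffun 'I_d -> 'I_M}}) :
  (0 < M)%N -> 0 <= p <= 1 -> (2 <= #|T|)%N ->
  `|Exp p (fun w : config d M n.+1 =>
      Vk k (\bigcap_(j in [set j | j \in T]) Fnj j w : set (pt R d)))| <=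
  'C(d, k)%:R * (M ^ n.+1)%:R ^- k *
    (6 ^ d * (M ^ n.+1) ^ d.-1)%:R * p ^+ n.+1.
Proof.
move=> M0 p01 T2.
have [j1 [j2 [j1T j2T j12]]] : exists j1 j2, [/\ j1 \in T, j2 \in T & j1 != j2].
  by have /card_gt1P[j1 [j2 [? ? ?]]] := T2; exists j1, j2.
have {j12}[i0 i012] : exists i0, j1 i0 != j2 i0.
  apply/existsP; apply: contraNT j12; rewrite negb_exists => /forallP h.
  by apply/eqP/ffunP => i; apply/eqP; rewrite -[_ == _]negbK.
(* In direction [i0] the two cubes can only meet where the one with the larger index begins; the
   factor 2 passes to half-grid units. *)
pose v := (2 * (maxn (j1 i0) (j2 i0) * M ^ n))%N.
have hv (w : config d M n.+1) (h : halfgrid d M n.+1) :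
    [forall j in T, hit_in j w h] -> h i0 = v :> nat.
  move=> /forall_inP H; rewrite /v.
  have := hit_in_range i0 (H _ j1T); have := hit_in_range i0 (H _ j2T).
  case: (ltngtP (j1 i0) (j2 i0)) => [lt|lt|/val_inj/eqP]; last by rewrite (negbTE i012).
    move=> /andP[h2 _] /andP[_ h1]; apply/eqP; rewrite eqn_leq h2 andbT.
    by rewrite (leq_trans h1)// -mulnDr leq_mul2l/= addnC -mulSn leq_mul2r lt orbT.
  move=> /andP[_ h2] /andP[h1 _]; apply/eqP; rewrite eqn_leq h1 andbT.
  by rewrite (leq_trans h2)// -mulnDr leq_mul2l/= addnC -mulSn leq_mul2r lt orbT.
set C := 'C(d, k)%:R * (M ^ n.+1)%:R ^- k.
have C0 : 0 <= C by rewrite mulr_ge0// invr_ge0 exprn_ge0.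
apply: le_trans (ler_norm_Exp _ p01) _.
(* Union bound: a point of the intersection lies on the face and in some kept cube, so its indicator
   is at most the number of kept cubes containing it. *)
apply: (@le_trans _ _ (Exp p (fun w : config d M n.+1 =>
   C * \sum_(h : halfgrid d M n.+1 | h i0 == v :> nat)
   \sum_(c : cidx d M n.+1)
     (incube (fun i => c i) (fun i => h i))%:R * (kept w c)%:R))).
  apply: le_Exp => // w; rewrite Vk_bigcap_Fnj//; last exact: ltnW.
  apply: le_trans (ler_norm_sum _ _ _) _.
  rewrite mulr_sumr [leRHS]big_mkcond/=; apply: ler_sum => h _.
  rewrite normrM; case: (boolP [forall j in T, hit_in j w h]) => H; last first.
    rewrite normr0 mulr0; case: ifP => // _.
    by apply: mulr_ge0 => //; apply: sumr_ge0 => c _; rewrite mulr_ge0.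
  rewrite (hv _ _ H) eqxx; apply: ler_pM => //; first exact: norm_grid_weight.
  rewrite normr1; have /existsP[c /andP[/andP[kc _] ch]] := forall_inP H _ j1T.
  rewrite (bigD1 c)//= kc ch mulr1 lerDl.
  by apply: sumr_ge0 => c' _; rewrite mulr_ge0.
rewrite ExpZ -mulrA; apply: ler_wpM2l => //.
rewrite Exp_sum; under eq_bigr do rewrite Exp_sum.
under eq_bigr do under eq_bigr do rewrite ExpZ Exp_kept.
under eq_bigr do rewrite -mulr_suml.
rewrite -mulr_suml; apply: ler_wpM2r; first by case/andP: p01 => ? _; exact: exprn_ge0.
under eq_bigr do rewrite -natr_sum.
by rewrite -natr_sum ler_nat sum_incube_slab.
Qed.

End IntersectionBound.

(** * Recursion and limit *)

Section Scaling.
Context {R : realType}.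

(** With [A = M^d p] and [r = 1/M] one has [r^D = 1/A], so the normalization is a plain integer
    power. *)
Lemma powR_dimension (M : nat) (A : R) (n k : nat) : (1 < M)%N -> 0 < A ->
  (M%:R^-1 : R) `^ (n%:R * (ln A / ln M%:R - k%:R)) = (M%:R ^+ k / A) ^+ n.
Proof.
move=> M1 A0; have M0 : (0 : R) < M%:R by rewrite ltr0n ltnW.
have r0 : (M%:R^-1 : R) != 0 by rewrite invr_neq0// gt_eqF.
have lnM0 : ln M%:R != 0 :> R by rewrite gt_eqF// ln_gt0// ltr1n.
rewrite mulrC powRrM powR_mulrn ?powR_ge0//; congr (_ ^+ n).
rewrite powRB; last by rewrite r0 implybT.
rewrite powR_mulrn ?invr_ge0// exprVn invrK mulrC; congr (_ * _).
rewrite /powR (negbTE r0) lnV ?posrE// mulrN divfK// expRN lnK//.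
Qed.

Lemma cvg_series_geometric_bound (u : R ^nat) (C z : R) :
  0 <= z < 1 -> (forall n, `|u n| <= C * z ^+ n) -> cvgn (series u).
Proof.
move=> /andP[z0 z1] uz; apply: normed_cvg.
apply: (series_le_cvg (v_ := geometric C z)) => [n|n|n|].
- exact: normr_ge0.
- by apply: le_trans (uz n); exact: normr_ge0.
- exact: uz.
- by apply: is_cvg_geometric_series; rewrite ger0_norm.
Qed.

End Scaling.

Section Recursion.
Context {R : realType} {d M k : nat}.
Variable p : R.
Hypotheses (d1 : (1 <= d)%N) (M2 : (2 <= M)%N) (p0 : 0 < p) (p1 : p <= 1).

Let M0 : (0 < M)%N. Proof. exact: ltnW. Qed.

Let q : R := M%:R ^+ k / (M%:R ^+ d * p).

Definition mean_Vk n : R :=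
  q ^+ n * Exp p (fun w : config d M n => Vk k (Fn w : set (pt R d))).

Definition mean_Vk_cap (T : {set {ffun 'I_d -> 'I_M}}) n : R :=
  q ^+ n * Exp p (fun w : config d M n =>
    Vk k (\bigcap_(j in [set j | j \in T]) Fnj j w : set (pt R d))).

Lemma norm_mean_Vk_cap (T : {set {ffun 'I_d -> 'I_M}}) n : (2 <= #|T|)%N ->
  `|mean_Vk_cap T n.+1| <= 'C(d, k)%:R * (6 ^ d)%:R * M%:R^-1 ^+ n.+1.
Proof.
move=> T2; have M0R : (0 : R) < M%:R by rewrite ltr0n.
have q0 : 0 < q by rewrite divr_gt0 ?mulr_gt0 ?exprn_gt0.
rewrite /mean_Vk_cap normrM (ger0_norm (exprn_ge0 _ (ltW q0))).
have p01 : 0 <= p <= 1 by rewrite ltW.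
have := norm_Exp_Vk_bigcap n k M0 p01 T2.
move=> /(ler_wpM2l (exprn_ge0 n.+1 (ltW q0))) /le_trans; apply.
set N := n.+1; rewrite natrM !natrX.
(* The powers of [M] and [p] cancel: per step [q] times [M^-k M^(d-1) p] leaves exactly [1/M]. *)
have -> : M%:R^-1 ^+ N = (q * M%:R ^- k * M%:R ^+ d.-1 * p) ^+ N.
  congr (_ ^+ N); rewrite /q -[in M%:R ^+ d](prednK d1) exprS.
  by field; rewrite ?gt_eqF ?exprn_gt0.
rewrite !exprMn !exprVn -!exprM ![(N * _)%N]mulnC.
by rewrite le_eqVlt; apply/orP; left; apply/eqP; ring.
Qed.

Lemma mean_VkS n : mean_Vk n.+1 = mean_Vk n +
  \sum_(T : {set {ffun 'I_d -> 'I_M}} | (2 <= #|T|)%N)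
    (-1) ^+ #|T|.-1 * mean_Vk_cap T n.+1.
Proof.
have M0R : (0 : R) < M%:R by rewrite ltr0n.
rewrite /mean_Vk; under eq_Exp do rewrite Vk_incl_excl//.
rewrite Exp_sum mulr_sumr (bigID (fun T : {set _} => #|T| == 1%N))/=.
congr (_ + _).
  (* The singletons reproduce the previous mean: there are [M^d] of them, each scaled by [M^-k p],
     and [q M^d M^-k p = 1]. *)
  rewrite (eq_bigl (fun T : {set {ffun 'I_d -> 'I_M}} => #|T| == 1%N)); last first.
    by move=> T; case: eqP => [->|]; rewrite ?andbF.
  rewrite (eq_bigl (fun T => T \in [set [set j]%SET | j in {ffun 'I_d -> 'I_M}]%SET)); last first.
    move=> T; apply/cards1P/imsetP => [[j ->]|[j _ ->]]; exists j => //.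
  rewrite big_imset/=; last by move=> i j _ _ /set1_inj.
  rewrite (eq_bigr (fun=> q ^+ n.+1 * (M%:R ^- k * p *
      Exp p (fun w : config d M n => Vk k (Fn w))))); last first.
    move=> j _; rewrite cards1 expr0; congr (_ * _).
    rewrite -(Exp_Vk_Fnj j)//; apply: eq_Exp => w; rewrite mul1r; congr Vk.
    by rewrite (_ : [set _ | _] = [set j]) ?bigcap_set1//;
      apply/seteqP; split=> x /=; rewrite inE => /eqP.
  rewrite sumr_const card_ffun !card_ord -[LHS]mulr_natl natrX exprS /q.
  by field; rewrite ?gt_eqF ?exprn_gt0.
apply: eq_big => [T|T _]; first by case: #|T| => [|[]].
by rewrite ExpZ mulrCA.
Qed.

Lemma mean_Vk0 : mean_Vk 0 = Vk k [set x : 'I_d -> R | forall i, 0 <= x i <= 1].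
Proof.
rewrite /mean_Vk expr0 mul1r.
rewrite (eq_Exp p (Y := fun w : config d M 0 =>
  Vk k [set x : 'I_d -> R | forall i, 0 <= x i <= 1] * 1)); last first.
  move=> w; rewrite mulr1; congr Vk; apply/seteqP; split=> x /=.
    move=> [c _ cx] i; have := cx i.
    have -> : nat_of_ord (c i) = 0%N.
      by case: (c i) => m /=; rewrite expn0 ltnS leqn0 => /eqP.
    by rewrite expn0 invr1 mul0r mulr1.
  have lt0 (i : 'I_d) : (0 < M ^ 0)%N by [].
  move=> h; exists [ffun i => Ordinal (lt0 i)] => /=.
    by apply/forallP => -[].
  by move=> i; rewrite ffunE/= expn0 invr1 mul0r mulr1.
rewrite ExpZ -[RHS]mulr1; congr (_ * _).
have lt0 : (0 < M ^ 0)%N by [].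
(* The total mass 1 is read off as the survival probability [p^0] of the unit cube. *)
rewrite -[RHS](expr0 p) -(Exp_kept p ([ffun=> Ordinal lt0] : cidx d M 0)).
by apply: eq_Exp => w; rewrite (_ : kept _ _ = true)//; apply/forallP => -[].
Qed.

Lemma mean_Vk_series n : mean_Vk n =
  Vk k [set x : 'I_d -> R | forall i, 0 <= x i <= 1] +
  \sum_(T : {set {ffun 'I_d -> 'I_M}} | (2 <= #|T|)%N)
    (-1) ^+ #|T|.-1 * series (fun m => mean_Vk_cap T m.+1) n.
Proof.
elim: n => [|n IH].
  rewrite mean_Vk0 big1 ?addr0// => T _.
  by rewrite /series/= big_nil mulr0.
rewrite mean_VkS IH -addrA; congr (_ + _); rewrite -big_split/=.
by apply: eq_bigr => T _; rewrite seriesSr mulrDr.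
Qed.

End Recursion.

Theorem theorem1p1 (R : realType) (d M : nat) (p : R) :
  (1 <= d)%N -> (2 <= M)%N ->
  (M%:R : R) ^- (minn 3 d) < p -> p <= 1 ->
  let D : R := ln ((M%:R : R) ^+ d * p) / ln (M%:R : R) in
  let r : R := (M%:R : R)^-1 in
  forall k : nat, (k <= d)%N ->
  let a := fun n : nat =>
    r `^ (n%:R * (D - k%:R)) *
      Exp p (fun w : config d M n => Vk k (Fn w)) in
  let b := fun (T : {set {ffun 'I_d -> 'I_M}}) (n : nat) =>
    r `^ (n%:R * (D - k%:R)) *
      Exp p (fun w : config d M n =>
               Vk k (\bigcap_(j in [set j | j \in T]) Fnj j w)) in
  (forall T : {set {ffun 'I_d -> 'I_M}}, (2 <= #|T|)%N ->
     cvgn (series (fun n => b T n.+1))) /\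
  a @ \oo --> Vk k [set x : 'I_d -> R | forall i, 0 <= x i <= 1] +
     \sum_(T : {set {ffun 'I_d -> 'I_M}} | (2 <= #|T|)%N)
        (-1) ^+ (#|T|.-1) * limn (series (fun n => b T n.+1)).
Proof.
move=> d1 M2 pM p1 D r k _ a b.
have M0 : (0 < M)%N by exact: ltnW.
have p0 : 0 < p by apply: le_lt_trans pM; rewrite invr_ge0 exprn_ge0.
have A0 : 0 < (M%:R : R) ^+ d * p by rewrite mulr_gt0 ?exprn_gt0 ?ltr0n.
have aE n : a n = mean_Vk (d := d) (M := M) (k := k) p n.
  by rewrite /a powR_dimension.
have bE T n : b T n = mean_Vk_cap (k := k) p T n by rewrite /b powR_dimension.
have bcvg (T : {set {ffun 'I_d -> 'I_M}}) : (2 <= #|T|)%N -> cvgn (series (fun n => b T n.+1)).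
  (* Comparison with a geometric series of ratio [1/M]; one more factor [1/M] enters the constant
     because the terms start at [n = 1]. *)
  move=> T2; apply: (@cvg_series_geometric_bound _ _
    ('C(d, k)%:R * (6 ^ d)%:R * M%:R^-1) M%:R^-1).
    by rewrite invr_ge0 ler0n invf_lt1 ?ltr0n ?ltr1n.
  by move=> n; rewrite bE (le_trans (norm_mean_Vk_cap _ _ _ _ _ _))// exprS mulrA.
split=> //.
(* Unrolling the recursion writes [a n] through the partial sums of [b T 1, ..., b T n]; the sum
   over [T] is finite, so limits pass termwise. *)
have -> : a = fun n => Vk k [set x : 'I_d -> R | forall i, 0 <= x i <= 1] +
    \sum_(T : {set {ffun 'I_d -> 'I_M}} | (2 <= #|T|)%N)
      (-1) ^+ #|T|.-1 * series (fun m => b T m.+1) n.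
  apply/funext => n; rewrite aE mean_Vk_series//; congr (_ + _).
  apply: eq_bigr => T _; congr (_ * _); apply: eq_bigr => m _.
  by rewrite bE.
apply: cvgD; first exact: cvg_cst.
apply: cvg_big => [|T T2]; first exact: add_continuous.
by apply: cvgMr; exact: bcvg.
Qed.
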